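(* Let $B$ be a predomain base for which $\ll$ is decidable and let $C$ be a bounded complete predomain base. Let $I$ be a finite set, $\alpha,\gamma_i\in B$ and $\beta,\delta_i\in C$ ($i\in I$), and let $\bigsqcup_{i\in I}\gamma_i\searrow\delta_i$ be a step function. Then the following are equivalent: (1) $\alpha\searrow\beta\sqsubseteq\bigsqcup_{i\in I}\gamma_i\searrow\delta_i$; (2) for all $x\in B$ with $\alpha\ll x$ we have $\beta\sqsubseteq\bigsqcup\{\delta_i\mid i\in I,\ \gamma_i\ll x\}$; (3) for every $I_0\subseteq I$ such that $A=\{\alpha\}\cup\{\gamma_i\mid i\in I_0\}$ and $D=\{\gamma_i\mid i\notin I_0\}$ are separated, we have $\beta\sqsubseteq\bigsqcup\{\delta_i\mid i\in I_0\}$.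
   Context: Work constructively; $\tilde\exists x.A$ abbreviates $\neg\forall x.\neg A$. In a poset, a chain is a sequence $(x_n)$ with $x_n\sqsubseteq x_{n+1}$; $b\ll c$ means: for every chain $(x_n)$ whose supremum exists with $c\sqsubseteq\bigsqcup_n x_n$, there weakly exists $n$ with $b\sqsubseteq x_n$. An approximating sequence of $b$ is a chain $(b_n)$ with $b_n\ll b$ for all $n$ and $\bigsqcup_n b_n=b$. A predomain base is a countable poset with decidable order in which every element has an approximating sequence. A nonempty finite subset is consistent if it weakly has an upper bound; a predomain base is bounded complete if every finite consistent subset has a least upper bound (a nonempty bounded complete base has a least element $\bot$, and $\bigsqcup\emptyset=\bot$). For $b\in B$, $c\in C$, the single step function $b\searrow c$ is the function $B\to C$ with $(b\searrow c)(x)=c$ if $b\ll x$ and $=\bot$ otherwise. A step function is a finite family $\{b_i\searrow c_i\}_{i\in I}$, written $\bigsqcup_{i\in I}b_i\searrow c_i$, such that for every nonempty $J\subseteq I$, if $\{b_j\mid j\in J\}$ is consistent then $\{c_j\mid j\in J\}$ is consistent; it denotes the function $x\mapsto\bigsqcup_{i\in I}(b_i\searrow c_i)(x)$. (Single) step functions are ordered by $s\sqsubseteq t$ iff $s(x)\sqsubseteq t(x)$ for all $x\in B$. Two subsets $A,D\subseteq B$ are separated if there weakly exists $\omega\in B$ with $a\ll\omega$ for all $a\in A$ and $\neg(d\ll\omega)$ for all $d\in D$. *)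

(* Defs.v *)
From HB Require Import structures.
From mathcomp Require Import all_boot all_order.

Set Implicit Arguments.
Unset Strict Implicit.
Unset Printing Implicit Defensive.

Import Order.TTheory.
Local Open Scope order_scope.

(* The weak existential quantifier, intuitionistically weaker than [exists]. *)
Definition wex (T : Type) (P : T -> Prop) : Prop := ~ forall x, ~ P x.

Section Posets.
Context {d : Order.disp_t} {T : porderType d}.
Implicit Types (A D : T -> Prop) (s : seq T) (x : nat -> T) (b c u : T).

Definition is_ub A u : Prop := forall a, A a -> a <= u.

Definition is_sup A u : Prop := is_ub A u /\ forall v, is_ub A v -> u <= v.

Definition chain x : Prop := forall n, x n <= x n.+1.

Definition chain_sup x u : Prop := is_sup (fun y => exists n, y = x n) u.

Definition way_below b c : Prop :=
  forall x u, chain x -> chain_sup x u -> c <= u -> wex (fun n => b <= x n).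

Definition approximating x b : Prop :=
  [/\ chain x, forall n, way_below (x n) b & chain_sup x b].

(* Finite subsets are given by lists; only membership matters.  The empty list
   is consistent as soon as [T] is weakly inhabited. *)
Definition consistent s : Prop := wex (fun u => is_ub (fun a => a \in s) u).

Definition separated A D : Prop :=
  wex (fun w => (forall a, A a -> way_below a w) /\
                (forall e, D e -> ~ way_below e w)).

End Posets.

(* The order of a [porderType] is boolean, hence decidable.  Countability is
   stated as in [countType]; [Countable] itself cannot be inherited here, because
   its only join with [Order.POrder] in the hierarchy is that of finite posets. *)
HB.mixin Record isPredomainBase (d : Order.disp_t) T of Order.POrder d T := {
  countable_ex :
    exists (f : T -> nat) (g : nat -> option T), pcancel f g;
  approximating_ex : forall b : T, exists x : nat -> T, approximating x b }.

#[short(type="predomainBaseType")]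
HB.structure Definition PredomainBase (d : Order.disp_t) :=
  { T of Order.POrder d T & isPredomainBase d T }.

(* Existence of least upper bounds is read constructively, as an operation on
   consistent finite subsets.  Its instance at the empty list yields the least
   element of a nonempty base. *)
HB.mixin Record isBoundedComplete (d : Order.disp_t) T
    of PredomainBase d T := {
  lub : forall s : seq T, consistent s -> T;
  lubP : forall (s : seq T) (h : consistent s),
    is_sup (fun a => a \in s) (lub s h) }.

#[short(type="bcPredomainBaseType")]
HB.structure Definition BCPredomainBase (d : Order.disp_t) :=
  { T of PredomainBase d T & isBoundedComplete d T }.

Lemma consistent_nil (d : Order.disp_t) (C : porderType d) (neC : inhabited C) :
  consistent ([::] : seq C).
Proof. by case: neC => c noub; apply: (noub c) => a. Qed.

Definition bottom (d : Order.disp_t) (C : bcPredomainBaseType d)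
  (neC : inhabited C) : C := lub [::] (consistent_nil neC).

Lemma bottom_le (d : Order.disp_t) (C : bcPredomainBaseType d)
  (neC : inhabited C) (c : C) : bottom neC <= c.
Proof. by have [_] := lubP _ (consistent_nil neC); apply=> a. Qed.

Section StepFunctions.
Context {dB dC : Order.disp_t}.
Context {B : predomainBaseType dB} {C : bcPredomainBaseType dC}.
Variable wb_dec : forall b c : B, decidable (way_below b c).
Variable neC : inhabited C.

Definition single_step (b : B) (c : C) (x : B) : C :=
  if wb_dec b x then c else bottom neC.

Definition fun_le (f g : B -> C) : Prop := forall x, f x <= g x.

Definition is_step_function (I : finType) (b : I -> B) (c : I -> C) : Prop :=
  forall J : {set I}, J != set0 ->
    consistent [seq b j | j in J] -> consistent [seq c j | j in J].

Lemma way_below_le (b x : B) : way_below b x -> b <= x.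
Proof.
move=> bx; apply/negPn/negP => nbx.
apply: (bx (fun=> x) x) => //; last by move=> n; apply/negP.
by split=> [y [_ ->] //|v]; apply; exists 0.
Qed.

Section Family.
Context {I : finType} {b : I -> B} {c : I -> C}.
Hypothesis bc_step : is_step_function b c.

Lemma step_consistent (J : {set I}) :
  consistent [seq b j | j in J] -> consistent [seq c j | j in J].
Proof.
case: (eqVneq J set0) => [-> _|]; last exact: bc_step.
case: neC => u noub; apply: (noub u) => a /imageP[j].
by rewrite in_set0.
Qed.

Definition active (x : B) : {set I} := [set i | wb_dec (b i) x].

Lemma active_consistent (x : B) : consistent [seq c i | i in active x].
Proof.
apply: step_consistent => noub; apply: (noub x) => a /imageP[i].
by rewrite inE; case: wb_dec => // bx _ ->; exact: way_below_le.
Qed.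

Lemma separated_consistent (alpha : B) (I0 : {set I}) :
  separated (fun a => a = alpha \/ exists2 i, i \in I0 & a = b i)
            (fun e => exists2 i, i \notin I0 & e = b i) ->
  consistent [seq c i | i in I0].
Proof.
move=> sep; apply: step_consistent => noub; apply: sep => w [Aw _].
apply: (noub w) => a /imageP[i iI0 ->].
by apply/way_below_le/Aw; right; exists i.
Qed.

Lemma step_values_consistent (x : B) :
  consistent [seq single_step (b i) (c i) x | i : I].
Proof.
move=> noub; apply: (active_consistent (x := x)) => u cu; apply: (noub u).
move=> a /imageP[i _ ->]; rewrite /single_step.
case E: (wb_dec (b i) x) => [bx|nbx]; last exact: bottom_le.
by apply: cu; apply: image_f; rewrite inE E.
Qed.

Definition step_fun (x : B) : C :=
  lub [seq single_step (b i) (c i) x | i : I] (@step_values_consistent x).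

End Family.
End StepFunctions.

Arguments active {dB B} wb_dec {I} b x.
Arguments active_consistent {dB dC B C} wb_dec neC {I b c} bc_step x _.
Arguments separated_consistent {dB dC B C} neC {I b c} bc_step {alpha I0} _ _.
Arguments step_fun {dB dC B C} wb_dec neC {I b c} bc_step x.
Arguments step_values_consistent {dB dC B C} wb_dec neC {I b c} bc_step x _.

(* Main.v *)
(** The supremum defining [step_fun x] is that of the [delta i] with
    [gamma i << x], since the other terms are bottom; this links (1) and (2).
    A point [x] with [alpha << x] separates [alpha] and the active [gamma i] from
    the inactive ones, which gives (3) => (2); conversely, if [w] separates [A]
    and [D], then the indices active at [w] are exactly those of [I0]. *)

Require Import Defs.
From HB Require Import structures.
From mathcomp Require Import all_boot all_order.

Set Implicit Arguments.
Unset Strict Implicit.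
Unset Printing Implicit Defensive.

Local Open Scope order_scope.
Import Order.TTheory.

Section Lub.
Context {d : Order.disp_t} {C : bcPredomainBaseType d}.
Implicit Types (s t : seq C) (c v : C).

Lemma le_lub s (h : consistent s) c : c \in s -> c <= lub s h.
Proof. by have [ub _] := lubP s h; apply: ub. Qed.

Lemma lub_le s (h : consistent s) v :
  (forall c, c \in s -> c <= v) -> lub s h <= v.
Proof. by have [_ least] := lubP s h; apply: least. Qed.

Lemma lub_sub s t (hs : consistent s) (ht : consistent t) :
  {subset s <= t} -> lub s hs <= lub t ht.
Proof. by move=> st; apply: lub_le => c /st; apply: le_lub. Qed.

End Lub.

Section Active.
Context {dB dC : Order.disp_t}.
Context {B : predomainBaseType dB} {C : bcPredomainBaseType dC}.
Variables (wb_dec : forall b c : B, decidable (way_below b c)).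
Variables (neC : inhabited C) (I : finType) (b : I -> B) (c : I -> C).

Lemma activeP x i : reflect (way_below (b i) x) (i \in active wb_dec b x).
Proof. by rewrite inE; case: (wb_dec _ _) => ?; constructor. Qed.

Lemma active_separated alpha x : way_below alpha x ->
  separated
    (fun a => a = alpha \/ exists2 i, i \in active wb_dec b x & a = b i)
    (fun e => exists2 i, i \notin active wb_dec b x & e = b i).
Proof.
move=> ax sep; apply: (sep x); split=> [a [-> //|[i /activeP bx -> //]]|].
by move=> e [i /activeP nbx ->].
Qed.

(** [lub] takes a consistency proof as argument; quantifying over [h] lets the equation rewrite both
    the supremum in (2) and the one obtained from (3), which carry different proofs. *)
Lemma step_fun_lub_active (step : is_step_function b c) x
    (h : consistent [seq c i | i in active wb_dec b x]) :
  step_fun wb_dec neC step x = lub [seq c i | i in active wb_dec b x] h.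
Proof.
apply: le_anti; apply/andP; split; apply: lub_le => a /imageP[i iA ->].
  rewrite /single_step; case: (wb_dec _ _) => [bx|nbx]; last exact: bottom_le.
  by apply: le_lub; apply: image_f; apply/activeP.
move/activeP: iA => bx; apply: le_lub; apply/imageP; exists i => //.
by rewrite /single_step; case: (wb_dec _ _).
Qed.

End Active.

Theorem theorem5p6 (dB dC : Order.disp_t)
    (B : predomainBaseType dB) (C : bcPredomainBaseType dC)
    (wb_dec : forall b c : B, decidable (way_below b c))
    (I : finType) (alpha : B) (beta : C) (gamma : I -> B) (delta : I -> C)
    (step : is_step_function gamma delta) :
  let neC : inhabited C := inhabits beta in
  [<->
    fun_le (single_step wb_dec neC alpha beta) (step_fun wb_dec neC step);
    forall x : B, way_below alpha x ->
      beta <= lub [seq delta i | i in active wb_dec gamma x]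
                  (active_consistent wb_dec neC step x);
    forall (I0 : {set I})
      (sep : separated
        (fun a => a = alpha \/ exists2 i, i \in I0 & a = gamma i)
        (fun e => exists2 i, i \notin I0 & e = gamma i)),
      beta <= lub [seq delta i | i in I0]
                  (separated_consistent neC step sep)].
Proof.
move=> neC; split; [|split].
- move=> le_step x ax; rewrite -(step_fun_lub_active neC step).
  by have := le_step x; rewrite {1}/single_step; case: (wb_dec _ _).
(* The order of [C] is boolean, hence stable under double negation, so the
   weakly existing separator [w] may be used to prove an inequality. *)
- move=> le_active I0 sep; apply/negPn/negP => /negP nle; apply: (sep) => w.
  case=> Aw Dw; apply: nle.
  have aw : way_below alpha w by apply: Aw; left.
  apply: le_trans (le_active w aw) _.
  (* An index active at [w] lies in [I0], since otherwise [Dw] would refute [gamma i << w];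
     membership in [I0] is boolean, so arguing by contradiction is constructive. *)
  apply: lub_sub => a /imageP[i /activeP iw ->].
  by apply: image_f; apply/negPn/negP => iI0; apply: Dw iw; exists i.
(* (3) => (1) closes the cycle: if [alpha << x] fails, the left side is bottom; otherwise (3) is
   taken at the set of indices active at [x]. *)
- move=> le_sep x; rewrite {1}/single_step; case: (wb_dec _ _) => [ax|nax] /=;
    last exact: bottom_le.
  have := le_sep (active wb_dec gamma x) (active_separated ax).
  by rewrite -(step_fun_lub_active neC step).
Qed.
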